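(* Let $L$ be a tense logic extending $\mathsf{S4BP}^{2,\omega}_{2,2}$. Then $L\subseteq\mathsf{Ga}$ if and only if $\mathbf{bz}_n\notin L$ for every $n\in\mathbb{Z}^+$.
   Context: Tense formulas use $\Box$, $\Diamond=\neg\Box\neg$ and a past possibility operator written here $\mathsf{P}$; $\mathsf{S4}_t=\mathsf{K}_t\oplus\{\Box p\to p,\Box p\to\Box\Box p\}$. $\mathsf{S4BP}^{2,\omega}_{2,2}$ is $\mathsf{S4}_t$ extended by axioms bounding depth, forth-width and back-width by 2 ($\mathbf{bd}_2=\Diamond(\Box p_1\wedge\neg(\Diamond\Box p_0\to p_0))\to p_1$, $\mathbf{bw}^+_2=\bigwedge_{i\leq2}\Diamond p_i\to\bigvee_{i\neq j\leq2}\Diamond(p_i\wedge(p_j\vee\Diamond p_j))$, $\mathbf{bw}^-_2$ the same with $\mathsf{P}$ for $\Diamond$). Let $\Delta\phi=\phi\vee\Diamond\phi\vee\mathsf{P}\phi$, $\Delta^{n+1}\phi=\Delta\Delta^n\phi$, and $\mathbf{bz}_n=\Delta^{n+1}p\to\Delta^np$ (z-degree at most $n$: every point of a rooted frame reachable within $n$ forward/backward steps). Let $\mathfrak{G}_\mathbb{Z}=(\mathbb{Z},R_z)$ with $R_z=\{(i,i):i\in\mathbb{Z}\}\cup\{(2i+1,2i):i\in\mathbb{Z}\}\cup\{(2i+1,2i+2):i\in\mathbb{Z}\}$ and $\mathsf{Ga}=\mathsf{Log}(\mathfrak{G}_\mathbb{Z})$. *)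

(* Defs.v *)
From mathcomp Require Import all_boot all_algebra.
From mathcomp Require Import classical_sets.

Set Implicit Arguments.
Unset Strict Implicit.
Unset Printing Implicit Defensive.

Import GRing.Theory.
Local Open Scope classical_set_scope.

Inductive tform : Type :=
| Var of nat
| Bot
| Imp of tform & tform
| Box of tform
| Past of tform.

Definition Neg (a : tform) : tform := Imp a Bot.
Definition Top : tform := Neg Bot.
Definition Or (a b : tform) : tform := Imp (Neg a) b.
Definition And (a b : tform) : tform := Neg (Imp a (Neg b)).
Definition Dia (a : tform) : tform := Neg (Box (Neg a)).
Definition Hist (a : tform) : tform := Neg (Past (Neg a)).

Fixpoint subst (s : nat -> tform) (a : tform) : tform :=
  match a with
  | Var i => s i
  | Bot => Bot
  | Imp b c => Imp (subst s b) (subst s c)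
  | Box b => Box (subst s b)
  | Past b => Past (subst s b)
  end.

(* Modalized subformulas are treated as atoms, so that [tautology] covers all
   substitution instances of classical propositional tautologies. *)
Fixpoint bool_eval (v : tform -> bool) (a : tform) : bool :=
  match a with
  | Bot => false
  | Imp b c => bool_eval v b ==> bool_eval v c
  | _ => v a
  end.

Definition tautology (a : tform) : Prop := forall v, bool_eval v a.

Record tense_logic (L : set tform) : Prop := TenseLogic {
  tl_taut : tautology `<=` L;
  tl_boxK : forall a b, L (Imp (Box (Imp a b)) (Imp (Box a) (Box b)));
  tl_histK : forall a b, L (Imp (Hist (Imp a b)) (Imp (Hist a) (Hist b)));
  tl_box_past : forall a, L (Imp a (Box (Past a)));
  tl_hist_dia : forall a, L (Imp a (Hist (Dia a)));
  tl_mp : forall a b, L (Imp a b) -> L a -> L b;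
  tl_box_nec : forall a, L a -> L (Box a);
  tl_hist_nec : forall a, L a -> L (Hist a);
  tl_subst : forall s a, L a -> L (subst s a)
}.

Definition oplus (L Sigma : set tform) : set tform :=
  \bigcap_(M in [set M | tense_logic M /\ L `|` Sigma `<=` M]) M.

Definition Kt : set tform := \bigcap_(M in [set M | tense_logic M]) M.

Definition S4t : set tform :=
  oplus Kt [set Imp (Box (Var 0)) (Var 0);
                Imp (Box (Var 0)) (Box (Box (Var 0)))].

Definition bd1 : tform := Imp (Dia (Box (Var 0))) (Var 0).
Definition bd2 : tform :=
  Imp (Dia (And (Box (Var 1)) (Neg bd1))) (Var 1).

(* Width axiom over the variables p_0, ..., p_n for the diamond-like
   operator [D], namely [Dia] for forth-width and [Past] for back-width. *)
Definition bw (D : tform -> tform) (n : nat) : tform :=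
  Imp (\big[And/Top]_(0 <= i < n.+1) D (Var i))
      (\big[Or/Bot]_(0 <= i < n.+1) \big[Or/Bot]_(0 <= j < n.+1 | i != j)
         D (And (Var i) (Or (Var j) (D (Var j))))).

(* S4BP^{2,omega}_{2,2}: depth, forth-width and back-width at most 2, and no
   bound (omega) on the z-degree. *)
Definition S4BP_2_omega_2_2 : set tform :=
  oplus S4t [set bd2; bw Dia 2; bw Past 2].

Definition Delta (a : tform) : tform := Or a (Or (Dia a) (Past a)).

Definition bz (n : nat) : tform :=
  Imp (iter n.+1 Delta (Var 0)) (iter n Delta (Var 0)).

Record frame : Type := Frame {
  world :> Type;
  acc : world -> world -> Prop
}.

Fixpoint sat (F : frame) (V : nat -> set F) (x : F) (a : tform) : Prop :=
  match a with
  | Var i => V i x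
  | Bot => False
  | Imp b c => sat V x b -> sat V x c
  | Box b => forall y, acc x y -> sat V y b
  | Past b => exists2 y, acc y x & sat V y b
  end.

Definition Log (F : frame) : set tform :=
  [set a | forall (V : nat -> set F) (x : F), sat V x a].

Definition Rz (x y : int) : Prop :=
  (x = y \/ exists i : int,
     x = 2 * i + 1 /\ (y = 2 * i \/ y = 2 * i + 2))%R.

Definition GZ : frame := Frame Rz.

Definition Ga : set tform := Log GZ.

(* Main.v *)
(* If some [bz_n] is in [L], then [L] is not contained in [Ga], since the zigzag
   of integers has unbounded z-degree.  Conversely, work in the canonical model
   of [L], whose accessibility relation is a preorder of depth, forth-width and
   back-width at most 2.  If [bz_n] is not in [L], some point [w] reaches [p] by
   a zigzag walk of length n+1 and no shorter one.  Along a shortest walk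
   x_{n+1} = w, ..., x_0 the steps alternate strictly between R and its
   converse, and the width bounds force every neighbour of an inner point to lie
   in the cluster of x_{i-1}, x_i or x_{i+1}: away from its ends the walk looks
   like a segment of the integer zigzag, with clusters as points.  The cluster
   of x_i is the level [Delta^i p /\ ~ Delta^{i-1} p] there, so any valuation
   on the integers pulls back along a substitution; for n large with respect to
   the modal depth of [b], truth of [b] at an integer is truth of its
   substitution instance at the middle of the walk, which holds if [b] is in
   [L]. *)
Require Import Defs.
From mathcomp Require Import all_boot all_algebra.
From mathcomp Require Import boolp classical_sets.
From mathcomp Require Import zify.

Set Implicit Arguments.
Unset Strict Implicit.
Unset Printing Implicit Defensive.

Local Open Scope classical_set_scope.

(** * Truth of derived connectives and of substitution instances *)

Lemma sat_And (F : frame) (V : nat -> set F) (x : F) a b :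
  sat V x (And a b) <-> sat V x a /\ sat V x b.
Proof.
split=> [h|[ha hb] h]; last exact: h ha hb.
by split; apply: contrapT => h'; apply: h => // ha.
Qed.

Lemma sat_Or (F : frame) (V : nat -> set F) (x : F) a b :
  sat V x (Or a b) <-> sat V x a \/ sat V x b.
Proof.
split=> [h|[ha na|hb _]//]; last by case: (na ha).
by case: (pselect (sat V x a)) => [|na]; [left|right; apply: h].
Qed.

Lemma sat_Dia (F : frame) (V : nat -> set F) (x : F) a :
  sat V x (Dia a) <-> exists2 y, acc x y & sat V y a.
Proof.
split=> [h|[y xy ya] h]; last exact: h _ xy ya.
by apply: contrapT => h'; apply: h => y xy ya; apply: h'; exists y.
Qed.

Lemma sat_bigAnd (F : frame) (V : nat -> set F) (x : F) (I : eqType)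
    (r : seq I) (P : pred I) (f : I -> tform) :
  sat V x (\big[And/Top]_(i <- r | P i) f i) <->
  (forall i, i \in r -> P i -> sat V x (f i)).
Proof.
elim: r => [|i r IH]; first by rewrite big_nil; split=> // _ [].
rewrite big_cons; case: ifP => Pi.
  rewrite sat_And IH; split=> [[hi hr] j|h].
    by rewrite inE => /orP[/eqP->|/hr].
  by split=> [|j jr]; apply: h; rewrite ?mem_head // inE jr orbT.
rewrite IH; split=> h j; last by move=> jr; apply: h; rewrite inE jr orbT.
by rewrite inE => /orP[/eqP->|/h//]; rewrite Pi.
Qed.

Lemma sat_bigOr (F : frame) (V : nat -> set F) (x : F) (I : eqType)
    (r : seq I) (P : pred I) (f : I -> tform) :
  sat V x (\big[Or/Bot]_(i <- r | P i) f i) <->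
  (exists i, [/\ i \in r, P i & sat V x (f i)]).
Proof.
elim: r => [|i r IH]; first by rewrite big_nil; split=> // -[i []].
rewrite big_cons; case: ifP => Pi.
  rewrite sat_Or IH; split=> [[hi|[j [jr Pj hj]]]|[j []]].
  - by exists i; rewrite mem_head.
  - by exists j; rewrite inE jr orbT.
  - rewrite inE => /orP[/eqP-> _ hi|jr Pj hj]; [by left|right].
    by exists j.
rewrite IH; split=> -[j [jr Pj hj]]; exists j; first by rewrite inE jr orbT.
by move: jr; rewrite inE => /orP[/eqP ji|//]; rewrite ji Pi in Pj.
Qed.

Lemma sat_subst (F : frame) (V : nat -> set F) (s : nat -> tform) a (x : F) :
  sat V x (subst s a) <-> sat (fun i y => sat V y (s i)) x a.
Proof.
elim: a x => //= [a IHa b IHb|a IHa|a IHa] x.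
- by rewrite IHa IHb.
- by split=> h y /h /IHa.
- by split=> -[y yx /IHa hy]; exists y.
Qed.

(** * Maximal consistent sets and the canonical model *)

Definition theory (L T : set tform) : Prop :=
  L `<=` T /\ (forall a b, T (Imp a b) -> T a -> T b).

Definition mcs (L x : set tform) : Prop :=
  [/\ theory L x, ~ x Bot & forall a, x a \/ x (Neg a)].

Definition normal_op (L : set tform) (M : tform -> tform) : Prop :=
  (forall a, L a -> L (M a)) /\
  (forall a b, L (Imp (M (Imp a b)) (Imp (M a) (M b)))).

Ltac case_atoms v :=
  match goal with
  | |- _ => reflexivity
  | |- context [bool_eval v ?a] => case: (bool_eval v a); case_atoms v
  | |- context [v ?a] => case: (v a); case_atoms v
  end.

Ltac taut :=
  rewrite /tautology /Top /Or /And /Dia /Hist /Neg;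
  let v := fresh "v" in intro v; cbn [bool_eval]; case_atoms v.

(** This is the theory generated by [c] and all [b] with [M b] in [T]. Taking [Box], [Hist] or the
    identity for [M] prepares a successor, a predecessor or an extension containing [c]. *)
Lemma theory_normal (L T : set tform) M c :
  tense_logic L -> normal_op L M -> theory L T ->
  theory L [set b | T (M (Imp c b))].
Proof.
move=> hL [nec K] [LT mp]; split=> [b Lb|a b /= hab ha].
  by apply/LT/nec/(tl_mp hL _ Lb)/(tl_taut hL); taut.
have h : L (Imp (Imp c (Imp a b)) (Imp (Imp c a) (Imp c b))).
  by apply: (tl_taut hL); taut.
by apply: mp (mp _ _ (LT _ (K _ _)) (mp _ _ (LT _ (tl_mp hL (K _ _) (nec _ h))) hab)) ha.
Qed.

Lemma lindenbaum (L T : set tform) :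
  tense_logic L -> theory L T -> ~ T Bot -> exists2 x, mcs L x & T `<=` x.
Proof.
move=> hL thT nT.
(* The case [set0] serves the empty chain, whose union is empty. *)
pose P X := X = set0 \/ [/\ theory L X, ~ X Bot & T `<=` X].
have LTop : L Top by apply: (tl_taut hL); taut.
have [|x [Px xmax]] := @Zorn_bigcup _ P.
  move=> C CP Ctot; have [[X CX X0]|nC] := pselect (exists2 X, C X & X Top).
    right; have good Y b : C Y -> Y b -> [/\ theory L Y, ~ Y Bot & T `<=` Y].
      by move=> /CP[->|].
    split; last by move=> b Tb; exists X => //; case: (good _ _ CX X0) => _ _; apply.
    - split=> [b Lb|a b [Y CY Yab] [Z CZ Za]].
        by exists X => //; case: (good _ _ CX X0) => -[LX _] _ _; apply: LX.
      have [YZ|ZY] := Ctot _ _ CY CZ.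
        by exists Z => //; case: (good _ _ CZ Za) => -[_ mp] _ _; apply: mp Za; apply: YZ.
      by exists Y => //; case: (good _ _ CY Yab) => -[_ mp] _ _; apply: mp Yab _; apply: ZY.
    - by move=> [Y CY Yb]; case: (good _ _ CY Yb).
  left; apply/seteqP; split=> // b [Y CY Yb]; apply: nC; exists Y => //.
  case: (CP _ CY) => [Y0|[[LY _] _ _]]; last exact: LY.
  by rewrite Y0 in Yb.
case: Px => [x0|[thx nx Tx]].
  have xT : x `<` T.
    rewrite x0; split; first exact: sub0set.
    by move=> /(_ Top); apply; apply: thT.1.
  by case: (xmax _ xT); right; split.
exists x => //; split=> // a; case: (pselect (x (Neg a))) => [|na]; first by right.
left; pose Y := [set b | x (Imp a b)].
have xY : x `<=` Y.
  move=> b xb; apply: thx.2 xb; apply: thx.1; apply: (tl_taut hL); taut.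
have thY : theory L Y.
  by apply: (@theory_normal L x id); rewrite //; split=> // c d; apply: (tl_taut hL); taut.
apply: contrapT => nxa; apply: (xmax Y); last first.
  by right; split=> //; apply: subset_trans xY.
split=> // Yx; apply: nxa; apply: Yx; apply: thx.1.
by apply: (tl_taut hL); taut.
Qed.

Lemma mcs_Imp (L x : set tform) a b :
  tense_logic L -> mcs L x -> x (Imp a b) <-> (x a -> x b).
Proof.
move=> hL [[Lx mp] nx tot]; split=> [|h]; first exact: mp.
have tt c : tautology c -> x c by move=> /(tl_taut hL)/Lx.
case: (tot a) => [/h xb|xna].
  by apply: mp xb; apply: tt; taut.
by apply: mp xna; apply: tt; taut.
Qed.

Lemma mcs_Neg (L x : set tform) a :
  tense_logic L -> mcs L x -> x (Neg a) <-> ~ x a.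
Proof.
move=> hL mx; rewrite (mcs_Imp _ _ hL mx); case: mx => _ nx _.
by split=> h /h.
Qed.

(* The hypothesis on [Past] is not automatic: [tense_logic] constrains [Past]
   through [Hist], that is, on negated formulas only. *)
Lemma canonical_model (L : set tform) :
  tense_logic L -> (forall a, L (Imp (Past a) (Past (Neg (Neg a))))) ->
  exists (F : frame) (V : nat -> set F),
    (forall a, L a <-> forall x : F, sat V x a) /\
    (forall x y : F, (forall a, sat V x (Box a) -> sat V y a) -> acc x y).
Proof.
move=> hL hP.
pose W := {x : set tform | mcs L x}.
pose R (x y : W) := forall a, sval x (Box a) -> sval y a.
pose F := @Frame W R; pose V i (x : F) := sval x (Var i).
have NB : normal_op L Box by split; [apply: tl_box_nec|apply: tl_boxK].
have NH : normal_op L Hist by split; [apply: tl_hist_nec|apply: tl_histK].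
have truth a : forall x : F, sat V x a <-> sval x a.
  elim: a => [i||a IHa b IHb|a IHa|a IHa] x //=.
  - by case: x => x [].
  - by rewrite IHa IHb (mcs_Imp _ _ hL (svalP x)).
  - split=> [h|xa y xy]; last by apply/IHa/xy.
    apply: contrapT => nxa; case: (svalP x) => thx _ _.
    have [|y my Ty] := lindenbaum hL (theory_normal (Neg a) hL NB thx).
      move=> /= hx; apply: nxa; apply: thx.2 hx; apply: thx.1.
      apply: tl_mp (tl_boxK hL _ _) _ => //; apply: (tl_box_nec hL).
      by apply: (tl_taut hL); taut.
    have : y (Neg a).
      by apply: Ty; apply: thx.1; apply: (tl_box_nec hL); apply: (tl_taut hL); taut.
    move=> /(mcs_Neg _ hL my); apply; apply/(IHa (exist _ y my))/h.
    move=> b xb; apply: Ty => /=; apply: thx.2 xb; apply: thx.1.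
    apply: tl_mp (tl_boxK hL _ _) _ => //; apply: (tl_box_nec hL).
    by apply: (tl_taut hL); taut.
  - split=> [[y yx /IHa ya]|xa].
      apply: yx; case: (svalP y) => -[Ly mp] _ _; apply: mp ya; apply: Ly.
      exact: tl_box_past.
    case: (svalP x) => thx _ _.
    have [|y my Ty] := lindenbaum hL (theory_normal a hL NH thx).
      move=> /= /(mcs_Neg _ hL (svalP x)); apply.
      by apply: thx.2 xa; apply: thx.1.
    exists (exist _ y my).
      move=> b /= yb; apply: contrapT => /(mcs_Neg _ hL (svalP x)) xnb.
      have /Ty : sval x (Hist (Imp a (Dia (Neg b)))).
        apply: thx.2 (thx.2 _ _ (thx.1 _ (tl_hist_dia hL _)) xnb); apply: thx.1.
        apply: tl_mp (tl_histK hL _ _) _ => //; apply: (tl_hist_nec hL).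
        by apply: (tl_taut hL); taut.
      move=> /(mcs_Neg _ hL my); apply; case: my => -[Ly mp] _ _.
      apply: mp yb; apply: Ly.
      apply: tl_mp (tl_boxK hL _ _) _ => //; apply: (tl_box_nec hL).
      by apply: (tl_taut hL); taut.
    apply/IHa/Ty => /=; apply: thx.1; apply: (tl_hist_nec hL).
    by apply: (tl_taut hL); taut.
exists F, V; split=> [a|x y h a xa]; last by apply/truth/h/truth.
split=> [La x|h]; first by apply/truth; case: (svalP x) => -[Lx _] _ _; apply: Lx.
apply: contrapT => nLa.
have Nid : normal_op L id by split=> // c d; apply: (tl_taut hL); taut.
have thL : theory L L by split=> // c d; apply: tl_mp.
have [|x mx Tx] := lindenbaum hL (theory_normal (Neg a) hL Nid thL).
  by move=> /= Lnna; apply: nLa; apply: tl_mp Lnna => //; apply: (tl_taut hL); taut.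
have : x (Neg a) by apply: Tx; apply: (tl_taut hL); taut.
by move=> /(mcs_Neg _ hL mx); apply; apply/(truth a (exist _ x mx))/h.
Qed.

(** * Frame conditions from the axioms *)

Lemma oplusl (L Sigma : set tform) : L `<=` oplus L Sigma.
Proof. by move=> a La M [_ LSM]; apply: LSM; left. Qed.

Lemma oplusr (L Sigma : set tform) : Sigma `<=` oplus L Sigma.
Proof. by move=> a Sa M [_ LSM]; apply: LSM; right. Qed.

Definition depth2 (W : Type) (R : W -> W -> Prop) : Prop :=
  forall x y z, R x y -> R y z -> R y x \/ R z y.

Definition width (n : nat) (W : Type) (R : W -> W -> Prop) : Prop :=
  forall x (y : nat -> W), (forall i, i <= n -> R x (y i)) ->
  exists i j, [/\ i <= n, j <= n, i != j & R (y i) (y j)].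

(** Were neither step reversible, some [Box a] would hold at [y] with [a] false at [x], and some
    [Box b] at [z] with [b] false at [y]; putting [b] for [p_0] and [a] for [p_1] refutes [bd2] at
    [x]. *)
Lemma depth2_of_bd2 (F : frame) (V : nat -> set F) :
  (forall x y : F, (forall a, sat V x (Box a) -> sat V y a) -> acc x y) ->
  (forall s (x : F), sat V x (subst s bd2)) ->
  depth2 (@acc F).
Proof.
move=> tight hbd x y z xy yz; apply: contrapT => /not_orP[nyx nzy].
have wit u v : ~ acc u v -> exists2 a, sat V u (Box a) & ~ sat V v a.
  move=> nuv; apply: contrapT => h; apply: nuv; apply: tight => a ua.
  by apply: contrapT => va; apply: h; exists a.
have [a ya nxa] := wit _ _ nyx; have [b zb nyb] := wit _ _ nzy.
pose s i := if i is 0 then b else a.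
pose U := fun i y => sat V y (s i).
have h : sat U x (Dia (And (Box (Var 1)) (Neg bd1))) -> sat U x (Var 1).
  exact: ((sat_subst V s bd2 x).1 (hbd s x)).
apply/nxa/h/sat_Dia; exists y => //; apply/sat_And; split=> // {}h.
have {}h : sat U y (Dia (Box (Var 0))) -> sat U y (Var 0) by exact: h.
by apply/nyb/h/sat_Dia; exists z.
Qed.

(** Abstract [D] and [R] cover both widths. If the [y i] are pairwise unrelated, separating formulas
    yield [s i], true at [y i], such that for distinct [i], [j] no point of [s i] is or sees a point
    of [s j]; this refutes [bw] at [x]. *)
Lemma width_of_bw n (F : frame) (V : nat -> set F) D (R : F -> F -> Prop) :
  (forall x, R x x) ->
  (forall U (x : F) a, sat U x (D a) <-> exists2 y, R x y & sat U y a) ->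
  (forall x y : F, (forall a, sat V x (Neg (D (Neg a))) -> sat V y a) -> R x y) ->
  (forall s (x : F), sat (fun i y => sat V y (s i)) x (bw D n)) ->
  width n R.
Proof.
move=> Rrefl satD tight hbw x y xy; apply: contrapT => nex.
have wit (ij : nat * nat) : exists a, [/\ ij.1 <= n, ij.2 <= n & ij.1 != ij.2] ->
    (forall v, R (y ij.1) v -> sat V v a) /\ ~ sat V (y ij.2) a.
  case: ij => i j /=; case: (pselect [/\ i <= n, j <= n & i != j]) => [[hi hj ij]|nij]; last first.
    by exists Bot => /nij.
  have nR : ~ R (y i) (y j) by move=> Rij; apply: nex; exists i, j.
  have [a ha] : exists a, ~ (sat V (y i) (Neg (D (Neg a))) -> sat V (y j) a).
    by apply/existsNP => h; apply/nR/tight.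
  exists a => _; have {ha} /not_implyP[ya na] := ha; split=> // v Rv.
  by apply: contrapT => nva; apply: ya; apply/satD; exists v.
have [a ha] := choice wit.
pose s i := \big[And/Top]_(0 <= j < n.+1 | i != j)
  And (Neg (D (Neg (a (i, j))))) (Neg (a (j, i))).
have ys i : i <= n -> sat V (y i) (s i).
  move=> hi; apply/sat_bigAnd => j; rewrite mem_index_iota ltnS => /andP[_ hj] ij.
  have [h1 _] := ha (i, j) (And3 hi hj ij).
  have [|_ h2] := ha (j, i); first by split=> //=; rewrite eq_sym.
  by apply/sat_And; split=> // /satD[v /h1 va]; apply.
have /(_ _)/sat_bigOr[|i [hi _ /sat_bigOr[j [hj ij]]]] := hbw s x.
  apply/sat_bigAnd => i; rewrite mem_index_iota ltnS => /andP[_ hi] _.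
  by apply/satD; exists (y i); [apply: xy|apply: ys].
move: hi hj; rewrite !mem_index_iota !ltnS => /andP[_ hi] /andP[_ hj].
move=> /satD[u xu /sat_And[ui uj]].
have uij : sat V u (Neg (D (Neg (a (i, j))))).
  by have /sat_And[] : sat V u (And (Neg (D (Neg (a (i, j))))) (Neg (a (j, i))))
    by move/sat_bigAnd: ui; apply=> //; rewrite mem_index_iota ltnS.
have hD v : R u v -> sat V v (a (i, j)).
  by move=> uv; apply: contrapT => nv; apply: uij; apply/satD; exists v.
have nj v : sat V v (s j) -> ~ sat V v (a (i, j)).
  move=> vj; have /sat_And[] : sat V v (And (Neg (D (Neg (a (j, i))))) (Neg (a (i, j)))).
    by move/sat_bigAnd: vj; apply; rewrite ?mem_index_iota ?ltnS // eq_sym.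
  by [].
move: uj => /sat_Or[uj|/satD[v uv vj]]; last exact: nj vj (hD _ uv).
exact: nj uj (hD _ (Rrefl u)).
Qed.

(* Instantiating all variables of [bw Past 2] by [a] gives
   [Past a -> Past (a /\ (a \/ Past a))], whose conclusion is the [Past] of a
   negation, to which the K axiom for [Hist] applies. *)
Lemma past_negneg (L : set tform) a :
  tense_logic L -> L (bw Past 2) -> L (Imp (Past a) (Past (Neg (Neg a)))).
Proof.
move=> hL /(tl_subst hL (fun=> a)); rewrite /bw unlock /index_iota /= => hbw.
(* [Neg c] is the conjunction under [Past] in the instance, so contraposing [hc] gives the goal. *)
pose c := Imp a (Neg (Or a (Past a))).
have hc : L (Imp (Hist (Neg a)) (Hist c)).
  apply: tl_mp (tl_histK hL _ _) _ => //; apply: (tl_hist_nec hL).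
  by apply: (tl_taut hL); rewrite /c; taut.
apply: tl_mp hc => //; apply: tl_mp hbw => //.
by apply: (tl_taut hL); rewrite /c; taut.
Qed.

(** * Geodesic walks in preorders of depth and width 2 *)

Definition adjacent (W : Type) (R : W -> W -> Prop) (u v : W) : Prop :=
  R u v \/ R v u.

Definition cluster (W : Type) (R : W -> W -> Prop) (u v : W) : Prop :=
  R u v /\ R v u.

Definition geodesic (W : Type) (R : W -> W -> Prop) (x : nat -> W) (N : nat) :=
  (forall i, i < N -> adjacent R (x i) (x i.+1)) /\
  (forall i, i.+2 <= N -> ~ adjacent R (x i) (x i.+2)).

(** The bit [c] is the phase of the zigzag: indices with [odd i (+) c] are its bottoms, the others
    its tops. *)
Definition alternating (W : Type) (R : W -> W -> Prop) (x : nat -> W) (N : nat)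
    (c : bool) :=
  forall i, i.+2 <= N ->
    if odd i (+) c then R (x i) (x i.+1) /\ ~ R (x i.+1) (x i)
    else R (x i.+1) (x i) /\ ~ R (x i) (x i.+1).

(** A reversible step, or two consecutive steps in one direction, would compose to a shortcut
    between points two apart. *)
Lemma geodesic_alternating (W : Type) (R : W -> W -> Prop) x N :
  (forall u v w, R u v -> R v w -> R u w) -> geodesic R x N ->
  exists c, alternating R x N c.
Proof.
move=> Rt [adj nadj].
have strict i : i.+2 <= N -> ~ (R (x i) (x i.+1) /\ R (x i.+1) (x i)).
  move=> hi [h1 h2]; apply: (nadj i hi).
  by case: (adj i.+1 hi) => h; [left; apply: Rt h|right; apply: Rt h2].
exists `[< R (x 0) (x 1) >]; elim=> [|i IH] hi /=.
  have := strict _ hi; have := adj 0 (ltnW hi); case: asboolP => h.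
    by move=> _ h'; split=> // h2; apply: h'.
  by case.
have := IH (ltnW hi); rewrite addNb; case: (_ (+) _) => /= -[h1 h2].
  have nh : ~ R (x i.+1) (x i.+2).
    by move=> h; apply: (nadj i (ltnW hi)); left; apply: Rt h.
  by case: (adj i.+1 (ltnW hi)).
have nh : ~ R (x i.+2) (x i.+1).
  by move=> h; apply: (nadj i (ltnW hi)); right; apply: Rt h1.
by case: (adj i.+1 (ltnW hi)).
Qed.

(** As [b] is strictly below [l], depth allows nothing strictly below [b]. For [v] above [b], width
    makes [v] comparable to [l] or [r], and depth then puts it in a cluster. *)
Lemma bottom_neighbours (W : Type) (R : W -> W -> Prop) b l r v :
  (forall u v w, R u v -> R v w -> R u w) -> depth2 R -> width 2 R ->
  R b l -> ~ R l b -> R b r -> ~ R r b -> ~ adjacent R l r ->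
  (R v b -> R b v) /\
  (R b v -> [\/ cluster R v b, cluster R v l | cluster R v r]).
Proof.
move=> Rt dep wid bl lb br rb nlr; split=> [vb|bv].
  by case: (dep _ _ _ vb bl) => // /lb.
have up y : R b y -> ~ R y b -> adjacent R v y -> cluster R v b \/ cluster R v y.
  move=> yb byn [vy|yv].
    by case: (dep _ _ _ bv vy) => h; [left|right].
  by case: (dep _ _ _ yb yv) => // h; right.
have [|i [j []]] := wid b (nth v [:: v; l; r]); first by case=> [|[|[|]]].
case: i j => [|[|[|//]]] [|[|[|//]]] _ _ //= _ h.
- by case: (up l) => //; [left|constructor 1|constructor 2].
- by case: (up r) => //; [left|constructor 1|constructor 3].
- by case: (up l) => //; [right|constructor 1|constructor 2].
- by case: nlr; left.
- by case: (up r) => //; [right|constructor 1|constructor 3].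
- by case: nlr; right.
Qed.

(** At a bottom, [bottom_neighbours] applies with the two neighbours on the walk; a top is a bottom
    of the converse relation, whose forth-width is the back-width of [R]. *)
Lemma geodesic_forth (W : Type) (R : W -> W -> Prop) x N c i u v :
  (forall u v w, R u v -> R v w -> R u w) -> depth2 R -> width 2 R ->
  width 2 (fun u v => R v u) ->
  geodesic R x N -> alternating R x N c -> 0 < i -> i.+2 <= N ->
  cluster R u (x i) -> R u v ->
  exists2 j, cluster R v (x j) &
    j = i \/ odd i (+) c /\ (j = i.+1 \/ i = j.+1).
Proof.
move=> Rt dep wid wid' [_ nadj] alt; case: i => // i _ hi [ui iu] uv.
have iv : R (x i.+1) v by apply: Rt uv.
have := alt i (ltnW hi); have := alt _ hi; rewrite /= addNb.
have nlr := nadj i (ltnW hi).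
case: (odd i (+) c) => /= -[h1 h2] [h3 h4].
  have dep' : depth2 (fun u v => R v u).
    by move=> a b d ab bd; case: (dep _ _ _ bd ab); [right|left].
  have Rt' a b d : R b a -> R d b -> R d a by move=> ba db; apply: Rt ba.
  have nlr' : ~ adjacent (fun u v => R v u) (x i) (x i.+2).
    by move=> [h|h]; apply: nlr; [right|left].
  have [/(_ iv) vi _] := bottom_neighbours v Rt' dep' wid' h3 h4 h1 h2 nlr'.
  by exists i.+1; [split|left].
have [_ /(_ iv)[vi|vl|vr]] := bottom_neighbours v Rt dep wid h3 h4 h1 h2 nlr.
- by exists i.+1; [|left].
- by exists i => //; right; split=> //; right.
- by exists i.+2 => //; right; split=> //; left.
Qed.

Lemma alternating_dual (W : Type) (R : W -> W -> Prop) x N c :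
  alternating R x N c -> alternating (fun u v => R v u) x N (~~ c).
Proof. by move=> alt i /alt; rewrite addbN; case: (_ (+) _). Qed.

(** * Bisimulation up to modal depth with the integer zigzag *)

Fixpoint modal_depth (a : tform) : nat :=
  match a with
  | Var _ | Bot => 0
  | Imp b c => maxn (modal_depth b) (modal_depth c)
  | Box b | Past b => (modal_depth b).+1
  end.

Lemma RzE (x y : int) :
  Rz x y <-> x = y \/
    (exists k : int, x = 2 * k + 1)%R /\ (y = x + 1 \/ x = y + 1)%R.
Proof.
split=> [[->|[i [-> [->|->]]]]|[->|[[k ->]] h]].
- by left.
- by right; split; [exists i|right; lia].
- by right; split; [exists i|left; lia].
- by left.
- by right; exists k; split=> //; lia.
Qed.

(** Odd integers are the bottoms of [Rz]; as [a] has the parity of [c], [a + i] is a bottom exactly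
    when [i] is one in a walk of phase [c]. *)
Lemma RzD (a : int) (c : bool) (i : nat) (y : int) :
  (exists k : int, a = 2 * k + c%:Z)%R ->
  (Rz (a + i%:Z)%R y <->
     y = (a + i%:Z)%R \/
     odd i (+) c /\ (y = (a + i%:Z) + 1 \/ (a + i%:Z) = y + 1)%R) /\
  (Rz y (a + i%:Z)%R <->
     y = (a + i%:Z)%R \/
     odd i (+) ~~ c /\ (y = (a + i%:Z) + 1 \/ a + i%:Z = y + 1)%R).
Proof.
move=> [k ->].
have odd_int : exists q : int,
    (2 * k + c%:Z + i%:Z = 2 * q + (odd i (+) c)%:Z)%R.
  have := odd_double_half i; case: (odd i) c => [] [] /=; move: (i./2) => h hi.
  - by exists (k + h%:Z + 1)%R; lia.
  - by exists (k + h%:Z)%R; lia.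
  - by exists (k + h%:Z)%R; lia.
  - by exists (k + h%:Z)%R; lia.
rewrite !RzE addbN; move: odd_int => [q].
move: (2 * k + _ + _)%R => x; case: (_ (+) _) => /= ->; split; split.
- by case=> [->|[_ h]]; [left|right].
- by case=> [->|[_ h]]; [left|right; split=> //; exists q; lia].
- by case=> [->|[[p ->] h]]; [left|lia].
- by case=> [->|[]//]; left.
- by case=> [->|[[p h] _]]; [left|lia].
- by case=> [->|[]//]; left.
- by case=> [->|[[p ->] h]]; [left|right; split=> //; lia].
- case=> [->|[_ h]]; [by left|right; split; last by lia].
  by case: h => h; [exists q|exists (q - 1)%R]; lia.
Qed.

(** The forth and back clauses between the cluster of [x i] and the integer [a + i]. [S] stands for
    [Rz] or its converse. *)
Lemma zigzag_step (W : Type) (R : W -> W -> Prop) x N c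
    (S : int -> int -> Prop) (a : int) i u :
  (forall u v w, R u v -> R v w -> R u w) -> depth2 R -> width 2 R ->
  width 2 (fun u v => R v u) ->
  geodesic R x N -> alternating R x N c ->
  (forall y, S (a + i%:Z)%R y <->
     y = (a + i%:Z)%R \/
     odd i (+) c /\ (y = (a + i%:Z) + 1 \/ (a + i%:Z) = y + 1)%R) ->
  0 < i -> i.+2 <= N -> cluster R u (x i) ->
  (forall v, R u v -> exists j,
     [/\ cluster R v (x j), S (a + i%:Z)%R (a + j%:Z)%R, i <= j.+1 & j <= i.+1]) /\
  (forall y, S (a + i%:Z)%R y -> exists j,
     [/\ y = (a + j%:Z)%R, R u (x j), i <= j.+1 & j <= i.+1]).
Proof.
move=> Rt dep wid wid' geo alt Sa i0 hi ui; split=> [v uv|y /Sa].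
  have [j vj hj] := geodesic_forth Rt dep wid wid' geo alt i0 hi ui uv.
  exists j; split=> //; try by case: hj => [|[_ []]] ->; lia.
  apply/Sa; case: hj => [->|[ic hj]]; [by left|right; split=> //].
  by case: hj => ->; lia.
case: ui => ui iu; case=> [->|[ic hy]]; first by exists i.
have [yE|yE] := hy.
  exists i.+1; split=> //; [by lia| |by lia]; apply: Rt ui _.
  by have := alt i hi; rewrite ic => -[].
case: i i0 hi ic ui yE {iu Sa hy} => // i _ hi ic ui yE; exists i.
split=> //; [by lia| |by lia]; apply: Rt ui _.
by have := alt i (ltnW hi); move: ic; rewrite /= addNb; case: (_ (+) _) => // _ [].
Qed.

(** Each modality moves the index by at most one, so a margin of [modal_depth b] at both ends
    suffices. The extra 2 is what the hypothesis on variables needs below and [zigzag_step]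
    above. *)
Lemma zigzag_bisim (F : frame) (V : nat -> set F) x N c (a : int)
    (U : nat -> set GZ) (s : nat -> tform) :
  (forall u : F, acc u u) -> (forall u v w : F, acc u v -> acc v w -> acc u w) -> depth2 (@acc F) ->
  width 2 (@acc F) -> width 2 (fun u v : F => acc v u) ->
  geodesic (@acc F) x N -> alternating (@acc F) x N c ->
  (exists k : int, a = 2 * k + c%:Z)%R ->
  (forall p i u, 2 <= i -> i <= N -> cluster (@acc F) u (x i) ->
     (sat V u (s p) <-> U p (a + i%:Z)%R)) ->
  forall b i u, (modal_depth b).+2 <= i -> (i + modal_depth b).+2 <= N ->
  cluster (@acc F) u (x i) ->
  (sat V u (subst s b) <-> sat U ((a + i%:Z)%R : GZ) b).
Proof.
move=> Rr Rt dep wid wid' geo alt ha hs.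
have geo' : geodesic (fun u v : F => acc v u) x N.
  by case: geo => h1 h2; split=> i hi; [case: (h1 _ hi); [right|left]|
    move=> h; apply: (h2 _ hi); case: h; [right|left]].
have dep' : depth2 (fun u v : F => acc v u).
  by move=> u v w uv vw; case: (dep _ _ _ vw uv); [right|left].
have Rt' (u v w : F) : acc v u -> acc w v -> acc w u by move=> vu wv; apply: Rt vu.
elim=> [p||b IHb d IHd|b IHb|b IHb] i u /= hb hN ui.
- by apply: hs => //; lia.
- by [].
- by rewrite (IHb i) ?(IHd i) //; lia.
- have [||//|forth back] := zigzag_step (u := u) Rt dep wid wid' geo alt
    (fun y => (RzD i y ha).1); try lia.
  split=> [h y /back[j [-> uj ij ji]]|h v /forth[j [vj ij h1 h2]]].
    by apply/(IHb j (x j)); [lia|lia|split|apply: h].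
  by apply/(IHb j v) => //; [lia|lia|apply: h].
- have [|||forth back] := zigzag_step (u := u) (S := fun m n => Rz n m)
    Rt' dep' wid' wid geo'
    (alternating_dual alt) (fun y => (RzD i y ha).2); try lia.
    by case: ui.
  split=> [[v /forth[j [vj ij h1 h2]] vb]|[y /back[j [-> uj ij ji]] yb]].
    exists (a + j%:Z)%R => //; apply/(IHb j v) => //; try lia.
    by case: vj.
  exists (x j) => //; apply/(IHb j (x j)); [lia|lia|split|]; by [].
Qed.

(** * Levels of iterated [Delta] and shortest walks *)

Lemma sat_Delta (F : frame) (V : nat -> set F) (x : F) a :
  (forall y : F, acc y y) ->
  sat V x (Delta a) <-> exists2 y, adjacent (@acc F) x y & sat V y a.
Proof.
move=> Rr; rewrite /Delta !sat_Or sat_Dia; split.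
  move=> [xa|[[y xy ya]|[y yx ya]]]; [exists x|exists y|exists y] => //.
  - by left.
  - by left.
  - by right.
by move=> [y [xy|yx] ya]; right; [left|right]; exists y.
Qed.

Lemma iter_Delta_le (F : frame) (V : nat -> set F) (x : F) a j k :
  (forall y : F, acc y y) -> j <= k ->
  sat V x (iter j Delta a) -> sat V x (iter k Delta a).
Proof.
move=> Rr; elim: k => [|k IH]; first by rewrite leqn0 => /eqP->.
rewrite leq_eqVlt => /orP[/eqP-> //|/IH h /h xk].
by apply/(sat_Delta _ _ _ Rr); exists x => //; left.
Qed.

(** A point at exact level [k.+1] has a neighbour at exact level [k]; descending builds the walk,
    indexed by level. A shortcut from [x i] to [x i.+2] would lower the level of the latter. *)
Lemma Delta_path (F : frame) (V : nat -> set F) a k (w : F) :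
  (forall y : F, acc y y) -> sat V w (iter k Delta a) ->
  (0 < k -> ~ sat V w (iter k.-1 Delta a)) ->
  exists x : nat -> F,
    (forall i, i <= k -> sat V (x i) (iter i Delta a) /\
       (0 < i -> ~ sat V (x i) (iter i.-1 Delta a))) /\
    geodesic (@acc F) x k.
Proof.
move=> Rr wk nwk.
suff [x [_ lev adj]] : exists x : nat -> F, [/\ x k = w,
    (forall i, i <= k -> sat V (x i) (iter i Delta a) /\
       (0 < i -> ~ sat V (x i) (iter i.-1 Delta a))) &
    forall i, i < k -> adjacent (@acc F) (x i) (x i.+1)].
  exists x; split=> //; split=> // i hi h; have [_ /(_ isT)] := lev _ hi; apply.
  have [xi _] := lev i (ltnW (ltnW hi)).
  by apply/(sat_Delta _ _ _ Rr); exists (x i) => //; case: h; [right|left].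
elim: k w wk nwk => [|k IH] w wk nwk.
  by exists (fun=> w); split=> // i; rewrite leqn0 => /eqP->.
have /(sat_Delta _ _ _ Rr)[y wy yk] := wk.
have [|x [xk lev adj]] := IH _ yk.
  case: k yk nwk {IH wk} => // k yk nwk _ yk'; apply: nwk => //.
  by apply/(sat_Delta _ _ _ Rr); exists y.
exists (fun i => if i <= k then x i else w); split.
- by rewrite ltnn.
- move=> i hi; case: (leqP i k) => h; first exact: lev.
  by have -> : i = k.+1 by lia.
- move=> i; rewrite ltnS => hi; rewrite {1}hi; case: (leqP i.+1 k) => h; first exact: adj.
  have -> : i = k by lia.
  by rewrite xk; case: wy; [right|left].
Qed.

Lemma int_parity (z : int) : exists (k : int) (c : bool), (z = 2 * k + c%:Z)%R.
Proof.
case: z => n; have := odd_double_half n; case: (odd n); move: (n./2) => h hn.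
- by exists h%:Z%R, true; lia.
- by exists h%:Z%R, false; lia.
- by exists (- h%:Z - 1)%R, false; lia.
- by exists (- h%:Z - 1)%R, true; lia.
Qed.

(** With [Var 0] true only at 0, [iter k Delta (Var 0)] fails beyond distance [k] from 0 but holds
    at [k]; so [n.+1] refutes [bz n]. *)
Lemma Ga_bz n : ~ Ga (bz n).
Proof.
pose U (i : nat) : set GZ := [set x | x = 0%R].
have Rr (y : GZ) : acc y y by left.
move=> /(_ U (n.+1%:Z%R : GZ)) h.
have up k (x : GZ) : sat U x (iter k Delta (Var 0)) -> (`|x : int| <= k%:Z)%R.
  elim: k x => [x /= ->//|k IH x /(sat_Delta _ _ _ Rr)[y xy /IH]].
  by case: xy => /RzE; lia.
have down k : sat U (k%:Z%R : GZ) (iter k Delta (Var 0)).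
  elim: k => [//|k IH]; apply/(sat_Delta _ _ _ Rr); exists (k%:Z%R : GZ) => //.
  have [q [[] kq]] := int_parity k%:Z%R.
    by right; apply/RzE; right; split; [exists q|left]; lia.
  by left; apply/RzE; right; split; [exists q|right]; lia.
by have /up := h (down n.+1); lia.
Qed.

(** For [i] at least 2, the [i]-th and [i.-1]-th iterates both start with [Delta], so they depend
    only on neighbours, which a cluster shares. Levels exclude each other, so only the disjunct at
    [i] can hold. *)
Lemma sat_level (F : frame) (V : nat -> set F) (x : nat -> F) N i u a
    (P : pred nat) :
  (forall y : F, acc y y) -> (forall u v w : F, acc u v -> acc v w -> acc u w) ->
  (forall i, i <= N -> sat V (x i) (iter i Delta a) /\
     (0 < i -> ~ sat V (x i) (iter i.-1 Delta a))) ->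
  2 <= i -> i <= N -> cluster (@acc F) u (x i) ->
  sat V u (\big[Or/Bot]_(0 <= k < N.+1 | P k)
    And (iter k Delta a) (Neg (iter k.-1 Delta a))) <-> P i.
Proof.
move=> Rr Rt lev i2 iN [ui iu].
have adj y : adjacent (@acc F) u y <-> adjacent (@acc F) (x i) y.
  by split=> -[h|h]; [left; apply: Rt h|right; apply: Rt ui|
    left; apply: Rt h|right; apply: Rt iu].
have same k : sat V u (iter k.+1 Delta a) <-> sat V (x i) (iter k.+1 Delta a).
  by split=> /(sat_Delta _ _ _ Rr)[y /adj uy ya]; apply/(sat_Delta _ _ _ Rr);
    exists y.
have [xi nxi] := lev _ iN.
have {}xi : sat V u (iter i Delta a) by case: i i2 {ui iu iN adj nxi} xi same => // i _ xi ->.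
have {}nxi : ~ sat V u (iter i.-1 Delta a).
  by case: i i2 {ui iu iN adj xi} nxi same => [|[]] // i _ nxi ->; apply: nxi.
rewrite sat_bigOr; split=> [[k [_ Pk /sat_And[uk nuk]]]|Pi].
  suff <- : k = i by [].
  case: (ltngtP k i) => // h; last first.
    by case: nuk; apply: iter_Delta_le xi => //; lia.
  by case: nxi; apply: iter_Delta_le uk => //; lia.
by exists i; rewrite mem_index_iota ltnS iN; split=> //; apply/sat_And.
Qed.

(** * Pulling back integer valuations, and the equivalence *)

Lemma zigzag_pullback (F : frame) (V : nat -> set F) (b : tform) :
  (forall u : F, acc u u) ->
  (forall u v w : F, acc u v -> acc v w -> acc u w) -> depth2 (@acc F) ->
  width 2 (@acc F) -> width 2 (fun u v : F => acc v u) ->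
  (forall n, 0 < n -> exists x : F, ~ sat V x (bz n)) ->
  (forall s (x : F), sat V x (subst s b)) -> Ga b.
Proof.
move=> Rr Rt dep wid wid' hbz hb U z.
(* [B] is the lower margin for [b]; [N] leaves the upper margin above [B.+1], the larger position
   allowed for [m]. *)
pose B := (modal_depth b).+2; pose N := (B + modal_depth b).+3.
have [w hw] := hbz N.-1 isT.
have [wN nw] : sat V w (iter N Delta (Var 0)) /\
    ~ sat V w (iter N.-1 Delta (Var 0)) by apply/not_implyP.
have [x [lev geo]] := Delta_path Rr wN (fun=> nw).
have [c alt] := geodesic_alternating Rt geo.
(* The phase [c] dictates the parity of [a]; two consecutive choices of [m] make it attainable for
   every [z]. *)
have [a [m [ha hm zE]]] : exists (a : int) (m : nat),
    [/\ exists k : int, a = (2 * k + c%:Z)%R, B <= m <= B.+1 &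
        z = (a + m%:Z)%R].
  have [k [d hk]] := int_parity (z - B%:Z)%R; move: hk.
  case: c d {alt} => [] [] hk.
  - by exists (z - B%:Z)%R, B; split; [exists k| |]; lia.
  - by exists (z - B.+1%:Z)%R, B.+1; split; [exists (k - 1)%R| |]; lia.
  - by exists (z - B.+1%:Z)%R, B.+1; split; [exists k| |]; lia.
  - by exists (z - B%:Z)%R, B; split; [exists k| |]; lia.
(* [s p] lists the levels [k] whose integer [a + k] lies in [U p]. *)
pose s p := \big[Or/Bot]_(0 <= k < N.+1 | `[< U p (a + k%:Z)%R >])
  And (iter k Delta (Var 0)) (Neg (iter k.-1 Delta (Var 0))).
have hs p i u : 2 <= i -> i <= N -> cluster (@acc F) u (x i) ->
    sat V u (s p) <-> U p (a + i%:Z)%R.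
  move=> i2 iN ui; apply: iff_trans (sat_level _ Rr Rt lev i2 iN ui) _.
  by split=> /asboolP.
have := hb s (x m); rewrite zE.
apply: (zigzag_bisim Rr Rt dep wid wid' geo alt ha hs _ _ _).1.
- by move: hm; rewrite /B; lia.
- by move: hm; rewrite /N /B; lia.
- by split.
Qed.

Theorem theorem7p5 (L : set tform) (hL : tense_logic L)
    (hext : S4BP_2_omega_2_2 `<=` L) :
  L `<=` Ga <-> (forall n : nat, (0 < n)%N -> ~ L (bz n)).
Proof.
split=> [LGa n _ /LGa|hbz b Lb]; first exact: Ga_bz.
have S4L : S4t `<=` L by apply: subset_trans hext; apply: oplusl.
have LT : L (Imp (Box (Var 0)) (Var 0)) by apply: S4L; apply: oplusr; left.
have L4 : L (Imp (Box (Var 0)) (Box (Box (Var 0)))).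
  by apply: S4L; apply: oplusr; right.
have Lbd : L bd2 by apply: hext; apply: oplusr; left; left.
have Lbf : L (bw Dia 2) by apply: hext; apply: oplusr; left; right.
have Lbp : L (bw Past 2) by apply: hext; apply: oplusr; right.
have [F [V [LE tight]]] := canonical_model hL (fun a => past_negneg a hL Lbp).
have valid s a (x : F) : L a -> sat V x (subst s a).
  by move=> La; apply: (LE _).1; apply: tl_subst.
have Rr (x : F) : acc x x by apply: tight => a; apply: (valid (fun=> a) _ x LT).
have Rt (x y z : F) : acc x y -> acc y z -> acc x z.
  move=> xy yz; apply: tight => a /(valid (fun=> a) _ x L4) /(_ _ xy).
  exact.
apply: (zigzag_pullback Rr Rt _ _ _ _ (fun s x => valid s b x Lb)).
- by apply: (depth2_of_bd2 tight) => s x; apply: valid.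
- apply: (width_of_bw (V := V) (D := Dia)) => //.
  + by move=> U x a; apply: sat_Dia.
  + move=> x y h; apply: tight => a xa; apply: h => /= h; apply: h => y' xy' na.
    by apply: na; apply: xa.
  + by move=> s x; apply/sat_subst/valid.
- apply: (width_of_bw (V := V) (D := Past)) => //.
  (* Tightness for the converse: if [a] fails at [x], then [Hist (Dia (Neg a))] holds there, so
     [Dia (Neg a)] holds at [y], against [Box a]. *)
  + move=> x y h; apply: tight => a ya; apply: contrapT => nxa.
    have /sat_Dia[z yz] : sat V y (Dia (Neg a)).
      apply: h => -[z zx nz].
      have zd : sat V z (Dia (Neg a)) by apply/sat_Dia; exists x.
      exact: nz zd.
    by apply; apply: ya.
  + by move=> s x; apply/sat_subst/valid.
- move=> n n0; apply: contrapT => h; apply: (hbz n n0); apply/LE => x.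
  by apply: contrapT => nx; apply: h; exists x.
Qed.
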